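(* Let $\mathbf{W}=(W_1,W_2,\dots,W_k)$ be a random vector where, for each $i=1,\dots,k$, $W_i$ is nonnegative with mean $\mu_i>0$ and variance $\sigma_i^2\in(0,\infty)$, and suppose that the moment generating function of $\mathbf{W}$ exists everywhere, i.e. $\mathbb{E}[e^{\boldsymbol{\theta}^t\mathbf{W}}]<\infty$ for all $\boldsymbol{\theta}\in\mathbb{R}^k$. Assume that there are couplings $\{\mathbf{W}^i\}_{i=1}^k$ of $\mathbf{W}$ (that is, for each $i$, $\mathbf{W}^i$ is defined on a common probability space with $\mathbf{W}$) such that $\mathbf{W}^i$ has the $\mathbf{W}$ size biased distribution in direction $i$ and $\|\mathbf{W}^i-\mathbf{W}\|_2\le K$ almost surely for each $i=1,\dots,k$, for some constant $K>0$. Let $\boldsymbol{\mu}=(\mu_1,\dots,\mu_k)$, $\boldsymbol{\sigma}=(\sigma_1,\dots,\sigma_k)$, $\sigma_{(1)}=\min_{i=1,\dots,k}\sigma_i$, and $$K_1=\frac{2K}{\sigma_{(1)}}\left\|\frac{\boldsymbol{\mu}}{\boldsymbol{\sigma}}\right\|_2,\qquad K_2=\frac{K}{2\sigma_{(1)}}.$$ Then for any $\mathbf{t}\in\mathbb{R}^k$ with $\mathbf{t}\succeq\mathbf{0}$, $$\mathbb{P}\left(\frac{\mathbf{W}-\boldsymbol{\mu}}{\boldsymbol{\sigma}}\preceq-\mathbf{t}\right)\le\exp\left(-\frac{\|\mathbf{t}\|_2^2}{2K_1}\right)$$ and $$\mathbb{P}\left(\frac{\mathbf{W}-\boldsymb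ol{\mu}}{\boldsymbol{\sigma}}\succeq\mathbf{t}\right)\le\exp\left(-\frac{\|\mathbf{t}\|_2^2}{2(K_1+K_2\|\mathbf{t}\|_2)}\right).$$
   Context: For a random vector $\mathbf{W}=(W_1,\dots,W_k)$ with nonnegative coordinates having finite nonzero means $\mu_i=\mathbb{E}[W_i]$, a random vector $\mathbf{W}^i=(W_1^i,\dots,W_k^i)$ has the $\mathbf{W}$ size biased distribution in direction $i$ if $\mathbb{E}[W_i f(\mathbf{W})]=\mu_i\,\mathbb{E}[f(\mathbf{W}^i)]$ for all functions $f$ for which these expectations exist; equivalently, if $\mathbf{W}$ has distribution $dF(\mathbf{x})$, then $\mathbf{W}^i$ has distribution $dF^i(\mathbf{x})=x_i\,dF(\mathbf{x})/\mu_i$. For $\mathbf{x},\mathbf{y}\in\mathbb{R}^k$, $\frac{\mathbf{x}}{\mathbf{y}}=\left(\frac{x_1}{y_1},\dots,\frac{x_k}{y_k}\right)$ denotes the coordinatewise quotient. The partial order $\succeq$ on $\mathbb{R}^k$ is defined by $\mathbf{x}\succeq\mathbf{y}$ iff $x_i\ge y_i$ for all $i=1,\dots,k$, and $\mathbf{x}\preceq\mathbf{y}$ iff $\mathbf{y}\succeq\mathbf{x}$. $\boldsymbol{\theta}^t$ is the transpose of $\boldsymbol{\theta}$ and $\|\cdot\|_2$ is the $l^2$ (Euclidean) norm on $\mathbb{R}^k$. *)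

(* Defs.v *)
From HB Require Import structures.
From mathcomp Require Import all_boot all_order all_algebra.
From mathcomp Require Import all_classical all_reals all_analysis.

Set Implicit Arguments.
Unset Strict Implicit.
Unset Printing Implicit Defensive.

Import Order.TTheory GRing.Theory Num.Theory.
Import numFieldNormedType.Exports.

Local Open Scope classical_set_scope.
Local Open Scope ring_scope.

(* Vectors of R^k are k-tuples: this is the finite power of R that carries the
   product sigma-algebra in the library, so that {RV P >-> k.-tuple R} is the
   type of R^k-valued random vectors. *)

Definition vsub (R : realType) (k : nat) (x y : k.-tuple R) : k.-tuple R :=
  [tuple tnth x i - tnth y i | i < k].

Definition vopp (R : realType) (k : nat) (x : k.-tuple R) : k.-tuple R :=
  [tuple - tnth x i | i < k].

Definition vdiv (R : realType) (k : nat) (x y : k.-tuple R) : k.-tuple R :=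
  [tuple tnth x i / tnth y i | i < k].

Definition vzero (R : realType) (k : nat) : k.-tuple R := [tuple 0 | i < k].

(* The coordinatewise order; the order that the library attaches to (aliases
   of) tuples is not used. *)
Definition vle (R : realType) (k : nat) (x y : k.-tuple R) : Prop :=
  forall i : 'I_k, tnth x i <= tnth y i.

Definition vdot (R : realType) (k : nat) (x y : k.-tuple R) : R :=
  \sum_(i < k) tnth x i * tnth y i.

(* The Euclidean norm; the library's norm on vectors is the sup norm. *)
Definition l2norm (R : realType) (k : nat) (x : k.-tuple R) : R :=
  Num.sqrt (\sum_(i < k) tnth x i ^+ 2).

(* The dimension is a successor so that the minimum is over a nonempty set;
   the initial value is itself one of the coordinates. *)
Definition vmin (R : realType) (n : nat) (x : n.+1.-tuple R) : R :=
  \big[Num.min/tnth x ord0]_(i < n.+1) tnth x i.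

Definition coordinate (T : Type) (R : realType) (k : nat)
  (X : T -> k.-tuple R) (i : 'I_k) : T -> R := fun w => tnth (X w) i.

Definition same_law (R : realType) (d d' d0 : measure_display)
  (T : measurableType d) (T' : measurableType d') (E : measurableType d0)
  (P : probability T R) (P' : probability T' R)
  (X : {RV P >-> E}) (Y : {RV P' >-> E}) : Prop :=
  forall A : set E, measurable A -> P (X @^-1` A) = P' (Y @^-1` A).

(* V has the W size biased distribution in direction i. The two vectors may
   live on different probability spaces, since only their laws matter. The
   expectations of W_i f(W) and f(V) exist when these are integrable. *)
Definition size_biased (R : realType) (k : nat) (d d' : measure_display)
  (T : measurableType d) (T' : measurableType d')
  (P : probability T R) (P' : probability T' R)
  (W : {RV P >-> k.-tuple R}) (V : {RV P' >-> k.-tuple R})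
  (i : 'I_k) : Prop :=
  forall f : k.-tuple R -> R, measurable_fun [set: k.-tuple R] f ->
    P.-integrable [set: T] (EFin \o (fun w => coordinate W i w * f (W w))) ->
    P'.-integrable [set: T'] (EFin \o (fun w => f (V w))) ->
    ('E_P[fun w => (coordinate W i w * f (W w))%R]
      = 'E_P[coordinate W i] * 'E_P'[fun w => f (V w)])%E.

(* Main.v *)
(* Tilt by X = theta . W and write M = E exp X. Size biasing turns
   E[W_i exp X] into mu_i E exp (theta . W^i), and the coupling together with
   Cauchy-Schwarz puts the latter between exp (-a) M and exp a M, where
   a = K |theta|. Summing over i bounds E[X exp X] by c M with
   c = exp (+-a) theta . mu, the sign being that of theta. Convexity then gives
   M <= exp c: integrate (1 + c - X) exp X <= exp c, which avoids integrating
   the logarithmic derivative of the moment generating function. Bounding that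
   derivative by its value at the endpoint costs a factor 2 in the exponent,
   exactly the slack present in K1. Chernoff's bound with theta proportional to
   +-t / sigma concludes. *)

Require Import Defs.
From HB Require Import structures.
From mathcomp Require Import all_boot all_order all_algebra.
From mathcomp Require Import all_classical all_reals all_analysis.
From mathcomp Require Import measurable_realfun lra ring.

Set Implicit Arguments.
Unset Strict Implicit.
Unset Printing Implicit Defensive.

Import Order.TTheory GRing.Theory Num.Theory.
Import numFieldNormedType.Exports.

Local Open Scope classical_set_scope.
Local Open Scope ring_scope.

(** * Elementary inequalities and the Euclidean norm *)

(** After clearing the denominator, the difference [g] of the two sides vanishes at 0 and has
    derivative [((1 - x) * expR x - 1) / 2], which is nonpositive because [1 - x <= expR (- x)]. In
    the upper tail the denominator [1 - a / 2] is what the [K2] term absorbs. *)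
Lemma expRB1_le (R : realType) (a : R) :
  0 <= a -> a < 2 -> expR a - 1 <= a / (1 - a / 2).
Proof.
move=> a_ge0 a_lt2.
have d_gt0 : 0 < 1 - a / 2 by lra.
rewrite ler_pdivlMr//.
pose g (x : R) : R := (expR x - 1) * (1 - x / 2) - x.
have dg (x : R) : is_derive x 1 g
    (expR x * (1 - x / 2) + (expR x - 1) * (- (1 / 2)) - 1).
  rewrite /g.
  apply: is_derive_eq.
  rewrite /GRing.scale/=; ring.
have : g a <= g 0.
  apply: (@ler0_derive1_le_cc R g 0 a) => //.
  - move=> x; rewrite in_itv/= => /andP[x0 xa].
    rewrite derive1E (@derive_val _ _ _ _ _ _ _ (dg x)).
    have := expR_ge1Dx (- x); rewrite expRN => h.
    have := expR_gt0 x => ex.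
    have : (1 - x) * expR x <= 1.
      by rewrite -ler_pdivlMr// div1r.
    lra.
  - apply: derivable_within_continuous => x _.
    exact: (@ex_derive _ _ _ _ _ _ _ (dg x)).
  - by rewrite in_itv/= lexx andbT.
  - by rewrite in_itv/= lexx.
rewrite /g expR0 subrr mul0r subr0; lra.
Qed.

(** Cauchy-Schwarz by normalisation: for unit vectors [|u * v| <= (u ^+ 2 + v ^+ 2) / 2] holds
    termwise, and the right-hand sides add up to 1. Vectors of norm zero cannot be normalised and
    are treated first. *)
Lemma norm_vdot_le (R : realType) (k : nat) (x y : k.-tuple R) :
  `|vdot x y| <= l2norm x * l2norm y.
Proof.
have sq_ge0 (z : k.-tuple R) : 0 <= \sum_(i < k) tnth z i ^+ 2.
  by apply: sumr_ge0 => i _; exact: sqr_ge0.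
have norm0 (z : k.-tuple R) : l2norm z = 0 -> forall i, tnth z i = 0.
  move=> /eqP; rewrite /l2norm sqrtr_eq0 => z0 i.
  have /eqP/psumr_eq0P : \sum_(i < k) tnth z i ^+ 2 == 0.
    by rewrite eq_le z0 sq_ge0.
  by move=> /(_ (fun _ _ => sqr_ge0 _) i isT)/eqP; rewrite sqrf_eq0 => /eqP.
have [x0|x_neq0] := eqVneq (l2norm x) 0.
  rewrite x0 mul0r normr_le0 /vdot big1// => i _.
  by rewrite (norm0 _ x0) mul0r.
have [y0|y_neq0] := eqVneq (l2norm y) 0.
  rewrite y0 mulr0 normr_le0 /vdot big1// => i _.
  by rewrite (norm0 _ y0) mulr0.
have unit (z : k.-tuple R) : l2norm z != 0 ->
    \sum_(i < k) (tnth z i / l2norm z) ^+ 2 = 1.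
  move=> z_neq0; under eq_bigr do rewrite expr_div_n.
  rewrite -mulr_suml -[X in X / _]sqr_sqrtr//.
  by apply: divff; rewrite expf_neq0.
have x_gt0 : 0 < l2norm x by rewrite lt0r x_neq0 sqrtr_ge0.
have y_gt0 : 0 < l2norm y by rewrite lt0r y_neq0 sqrtr_ge0.
have -> : vdot x y = l2norm x * l2norm y *
    \sum_(i < k) (tnth x i / l2norm x) * (tnth y i / l2norm y).
  rewrite mulr_sumr; apply: eq_bigr => i _.
  by rewrite mulrACA; congr (_ * _); rewrite mulrC divfK.
rewrite normrM [X in X * _]ger0_norm ?mulr_ge0 ?sqrtr_ge0//.
rewrite ler_piMr ?mulr_ge0 ?sqrtr_ge0//.
have -> : 1 = \sum_(i < k)
    ((tnth x i / l2norm x) ^+ 2 + (tnth y i / l2norm y) ^+ 2) / 2.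
  by rewrite -mulr_suml big_split/= !unit// -[1 + 1]/(2%:R) divff// pnatr_eq0.
apply: le_trans (ler_norm_sum _ _ _) _; apply: ler_sum => i _.
move: (tnth x i / _) (tnth y i / _) => u v.
rewrite ler_norml; apply/andP; split.
  have := sqr_ge0 (u + v); lra.
have := sqr_ge0 (u - v); lra.
Qed.

Lemma vmin_le (R : realType) (n : nat) (x : n.+1.-tuple R) i :
  vmin x <= tnth x i.
Proof. exact: bigmin_le_cond. Qed.

Lemma vmin_gt0 (R : realType) (n : nat) (x : n.+1.-tuple R) :
  (forall i, 0 < tnth x i) -> 0 < vmin x.
Proof. by move=> x0; apply: lt_bigmin. Qed.

(** * Measurability and integrals of exponentials *)

Lemma measurable_vdot (R : realType) (k : nat) (theta : k.-tuple R) :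
  measurable_fun [set: k.-tuple R] (vdot theta).
Proof.
apply: measurable_sum => i; apply: measurable_funM => //.
exact: measurable_tnth.
Qed.

Lemma measurable_expR_vdot (R : realType) (k : nat) (theta : k.-tuple R) :
  measurable_fun [set: k.-tuple R] (fun x => expR (vdot theta x)).
Proof.
by apply: (@measurableT_comp _ _ _ _ _ _ expR) => //; exact: measurable_vdot.
Qed.

(** Both sides integrate [f] against the same image measure. Assuming [f] nonnegative rather than
    integrable lets finiteness pass from one side to the other. *)
Lemma same_law_expectation (R : realType) (d d' d0 : measure_display)
  (T : measurableType d) (T' : measurableType d') (E : measurableType d0)
  (P : probability T R) (P' : probability T' R)
  (X : {RV P >-> E}) (Y : {RV P' >-> E}) (f : E -> R) :
  same_law X Y -> measurable_fun [set: E] f -> (forall x, 0 <= f x) ->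
  ('E_P[f \o X] = 'E_P'[f \o Y])%E.
Proof.
move=> XY mf f_ge0; rewrite unlock.
have mf' : measurable_fun [set: E] (EFin \o f) by exact/measurable_EFinP.
have f_ge0' y : (0 <= (EFin \o f) y)%E by rewrite lee_fin.
have <- := ge0_integral_distribution X mf' f_ge0'.
have <- := ge0_integral_distribution Y mf' f_ge0'.
by apply: eq_measure_integral => A mA _; exact: XY.
Qed.

(** Multiply [1 + (c - X) <= expR (c - X)] by [expR X] and integrate: the bound on the integral of
    [X * expR X] cancels the [c] terms, leaving the integral of [expR X] alone on the left. *)
Lemma Rintegral_expR_le (R : realType) (d : measure_display)
  (T : measurableType d) (P : probability T R) (X : T -> R) (c : R) :
  P.-integrable [set: T] (EFin \o (fun w => expR (X w))) ->
  P.-integrable [set: T] (EFin \o (fun w => X w * expR (X w))) ->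
  \int[P]_w (X w * expR (X w)) <= c * \int[P]_w expR (X w) ->
  \int[P]_w expR (X w) <= expR c.
Proof.
move=> ie iXe Xe_le.
have ic : P.-integrable [set: T] (EFin \o (fun w => (1 + c) * expR (X w))).
  exact: (integrableZl measurableT (1 + c) ie).
have icst : P.-integrable [set: T] (EFin \o (fun=> expR c)).
  exact: finite_measure_integrable_cst.
have : \int[P]_w ((1 + c) * expR (X w) - X w * expR (X w)) <=
    \int[P]_w expR c.
  apply: le_Rintegral => //; first exact: (integrableB measurableT ic iXe).
  move=> w _; rewrite -mulrBl -ler_pdivlMr ?expR_gt0//.
  rewrite -expRB -addrA; exact: expR_ge1Dx.
rewrite RintegralB// RintegralZl// Rintegral_cst//.
have -> : fine (P setT) = 1 by rewrite probability_setT.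
lra.
Qed.

(** * Integrability under exponential tilts *)

Lemma vdot_shift (R : realType) (k : nat) (theta x : k.-tuple R) (i : 'I_k)
  (c : R) :
  vdot [tuple tnth theta j + c *+ (j == i) | j < k] x =
  vdot theta x + c * tnth x i.
Proof.
rewrite /vdot; under eq_bigr do rewrite tnth_mktuple mulrDl.
rewrite big_split/=; congr (_ + _).
rewrite (bigD1 i)//= eqxx mulr1n big1 ?addr0// => j /negPf ->.
by rewrite mulr0n mul0r.
Qed.

Lemma integrable_expR_vdot (R : realType) (k : nat) (d : measure_display)
  (T : measurableType d) (P : probability T R) (W : {RV P >-> k.-tuple R})
  (theta : k.-tuple R) :
  ('E_P[fun w => expR (vdot theta (W w))] < +oo)%E ->
  P.-integrable [set: T] (EFin \o (fun w => expR (vdot theta (W w)))).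
Proof.
rewrite unlock => W_mgf; apply/integrableP; split.
  apply/measurable_EFinP.
  exact: (measurableT_comp (measurable_expR_vdot theta) (measurable_funPT W)).
under eq_integral do rewrite /= ger0_norm ?expR_ge0//.
exact: W_mgf.
Qed.

(** Since [|x| <= expR x + expR (- x)], the integrand is dominated by the sum of the exponentials
    for [theta] shifted by 1 and by -1 in coordinate [i]. *)
Lemma integrable_coordinate_expR_vdot (R : realType) (k : nat)
  (d : measure_display) (T : measurableType d) (P : probability T R)
  (W : {RV P >-> k.-tuple R}) (theta : k.-tuple R) (i : 'I_k) :
  (forall theta : k.-tuple R,
    ('E_P[fun w => expR (vdot theta (W w))] < +oo)%E) ->
  P.-integrable [set: T]
    (EFin \o (fun w => coordinate W i w * expR (vdot theta (W w)))).
Proof.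
move=> W_mgf.
pose shift c : k.-tuple R := [tuple tnth theta j + c *+ (j == i) | j < k].
have ishift c := @integrable_expR_vdot R k d T P W (shift c) (W_mgf (shift c)).
apply: le_integrable (integrableD _ (ishift 1) (ishift (- 1))) => //.
  apply/measurable_EFinP; apply: measurable_funM.
    exact: (measurableT_comp (measurable_tnth i) (measurable_funPT W)).
  exact: (measurableT_comp (measurable_expR_vdot theta) (measurable_funPT W)).
move=> w _; rewrite /= lee_fin !vdot_shift mul1r mulN1r !expRD -mulrDr.
rewrite normrM mulrC [X in X * _]ger0_norm ?expR_ge0//.
rewrite [leRHS]ger0_norm ?mulr_ge0 ?addr_ge0 ?expR_ge0//.
rewrite ler_pM2l ?expR_gt0// /coordinate; move: (tnth _ _) => x.
have := expR_ge1Dx x; have := expR_ge1Dx (- x).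
have := expR_ge0 x; have := expR_ge0 (- x).
by rewrite ler_norml => *; apply/andP; split; lra.
Qed.

(** * Size biasing under a tilt *)

(** [W'] is the copy of [W] on the space of the coupling; [V] is compared with it pointwise, and its
    exponential moment is carried back to [W] by equality of laws. Both bounds are kept because the
    sign of the tilt decides which one is used. *)
Lemma tilted_mean_bounds (R : realType) (k : nat)
  (d d' : measure_display) (T : measurableType d) (T' : measurableType d')
  (P : probability T R) (P' : probability T' R)
  (W : {RV P >-> k.-tuple R}) (W' V : {RV P' >-> k.-tuple R})
  (i : 'I_k) (m K : R) (theta : k.-tuple R) :
  (forall theta : k.-tuple R,
    ('E_P[fun w => expR (vdot theta (W w))] < +oo)%E) ->
  ('E_P[coordinate W i] = m%:E)%E -> 0 <= m ->
  same_law W' W -> size_biased W V i ->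
  {ae P', forall w, l2norm (vsub (V w) (W' w)) <= K} ->
  m * (expR (- (l2norm theta * K)) * \int[P]_w expR (vdot theta (W w))) <=
    \int[P]_w (coordinate W i w * expR (vdot theta (W w))) <=
  m * (expR (l2norm theta * K) * \int[P]_w expR (vdot theta (W w))).
Proof.
move=> W_mgf W_mean m_ge0 lawW' biased close.
set a := l2norm theta * K; set M := \int[P]_w expR (vdot theta (W w)).
pose f (x : k.-tuple R) := expR (vdot theta x).
have mf : measurable_fun setT f := measurable_expR_vdot theta.
have f_ge0 x : 0 <= f x := expR_ge0 _.
have closef : {ae P', forall w,
    (expR (- a) * f (W' w) <= f (V w)) /\ (f (V w) <= expR a * f (W' w))}.
  apply: filterS close => w closew.
  have : `|vdot theta (V w) - vdot theta (W' w)| <= a.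
    rewrite (_ : _ - _ = vdot theta (vsub (V w) (W' w))); last first.
      rewrite /vdot -sumrB; apply: eq_bigr => j _.
      by rewrite tnth_mktuple mulrBr.
    apply: le_trans (norm_vdot_le _ _) _.
    by rewrite ler_wpM2l// sqrtr_ge0.
  by rewrite ler_norml -!expRD !ler_expR => /andP[]; split; lra.
have M_fin : ('E_P[f \o W] = M%:E)%E.
  rewrite unlock fineK//; apply: integrable_fin_num => //.
  exact: integrable_expR_vdot.
have EW' c : ('E_P'[fun w => (c * f (W' w))%R] = (c * M)%:E)%E.
  have if' : P'.-integrable setT (EFin \o (f \o W')).
    apply: integrable_expR_vdot.
    by have -> := same_law_expectation lawW' mf f_ge0; rewrite M_fin ltry.
  rewrite EFinM -M_fin -(same_law_expectation lawW' mf f_ge0).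
  by rewrite unlock -integralZl.
have mfV : measurable_fun setT (f \o V) by exact: measurableT_comp.
have mfW' c : measurable_fun setT (fun w => c * f (W' w)).
  by apply: measurable_funM => //; exact: measurableT_comp.
have fW'_ge0 c w : 0 <= expR c * f (W' w) by rewrite mulr_ge0 ?expR_ge0.
have EV_le : ('E_P'[f \o V] <= (expR a * M)%:E)%E.
  rewrite -EW'; apply: expectation_le => //; first by move=> w; exact: f_ge0.
  by apply: filterS closef => w [].
have EV_ge : ((expR (- a) * M)%:E <= 'E_P'[f \o V])%E.
  rewrite -EW'; apply: expectation_le => //; first by move=> w; exact: f_ge0.
  by apply: filterS closef => w [].
(* Size biasing applies to [f] only once [f \o V] is integrable, which follows from the upper bound
   just obtained. *)
have ifV : P'.-integrable setT (EFin \o (f \o V)).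
  by apply: integrable_expR_vdot; apply: le_lt_trans EV_le _; rewrite ltry.
have := biased f mf (integrable_coordinate_expR_vdot theta i W_mgf) ifV.
rewrite W_mean => biasedf.
have EV_fin : ('E_P'[f \o V] = (fine 'E_P'[f \o V])%:E)%E.
  by rewrite fineK// unlock; exact: integrable_fin_num.
rewrite EV_fin in EV_le EV_ge biasedf.
have -> : \int[P]_w (coordinate W i w * expR (vdot theta (W w))) =
    m * fine 'E_P'[f \o V].
  by apply/EFin_inj; rewrite EFinM -biasedf unlock fineK// integrable_fin_num//;
    exact: integrable_coordinate_expR_vdot.
by rewrite !ler_wpM2l.
Qed.

(** * From tilted means to tail bounds *)

Lemma l2norm_le_scale (R : realType) (k : nat) (x y : k.-tuple R) (c : R) :
  0 <= c -> (forall i, `|tnth x i| <= c * `|tnth y i|) ->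
  l2norm x <= c * l2norm y.
Proof.
move=> c_ge0 xy.
rewrite -[c in leRHS]ger0_norm// -sqrtr_sqr -sqrtrM ?sqr_ge0//.
rewrite ler_sqrt ?mulr_ge0 ?sqr_ge0 ?sumr_ge0//; last first.
  by move=> i _; exact: sqr_ge0.
rewrite mulr_sumr; apply: ler_sum => i _.
rewrite -[tnth x i ^+ 2]real_normK ?num_real//.
rewrite -[tnth y i ^+ 2]real_normK ?num_real// -exprMn.
by rewrite ler_sqr ?nnegrE ?mulr_ge0.
Qed.

Lemma Rintegral_sum (R : realType) (d : measure_display)
  (T : measurableType d) (mu : {measure set T -> \bar R}) (I : Type)
  (s : seq I) (f : I -> T -> R) :
  (forall i, mu.-integrable [set: T] (EFin \o f i)) ->
  \int[mu]_w (\sum_(i <- s) f i w) = \sum_(i <- s) \int[mu]_w f i w.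
Proof.
move=> fi; elim: s => [|i s IH].
  rewrite big_nil; under eq_Rintegral do rewrite big_nil.
  by rewrite /Rintegral integral0.
rewrite big_cons -IH -RintegralD//; last first.
  have := @integrable_sum _ _ _ mu _ measurableT _ s xpredT _ (fun i _ => fi i).
  by under eq_fun do rewrite sumEFin.
by apply: eq_Rintegral => w _; rewrite big_cons.
Qed.

(** Summing the hypothesis over [i] bounds the tilted mean of [vdot theta W] by [b * vdot theta mu],
    which controls the moment generating function; Chernoff then gives the tail. The factor
    [tnth theta i] on both sides of the hypothesis lets one form serve both signs of [theta]. *)
Lemma vdot_tail_le (R : realType) (k : nat) (d : measure_display)
  (T : measurableType d) (P : probability T R) (W : {RV P >-> k.-tuple R})
  (mu theta : k.-tuple R) (b s : R) (A : set T) :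
  (forall theta : k.-tuple R,
    ('E_P[fun w => expR (vdot theta (W w))] < +oo)%E) ->
  (forall i, tnth theta i *
      \int[P]_w (coordinate W i w * expR (vdot theta (W w))) <=
    tnth theta i * (tnth mu i * (b * \int[P]_w expR (vdot theta (W w))))) ->
  measurable A -> (forall w, A w -> s <= vdot theta (W w)) ->
  (P A <= (expR (b * vdot theta mu - s))%:E)%E.
Proof.
move=> W_mgf tilted mA sA.
have ie := integrable_expR_vdot (W_mgf theta).
have iW i := integrable_coordinate_expR_vdot theta i W_mgf.
have iWi i : P.-integrable [set: T] (EFin \o (fun w => tnth theta i *
    (coordinate W i w * expR (vdot theta (W w))))).
  exact: (integrableZl measurableT (tnth theta i) (iW i)).
have sumE w : vdot theta (W w) * expR (vdot theta (W w)) =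
    \sum_(i < k) tnth theta i * (coordinate W i w * expR (vdot theta (W w))).
  by rewrite [X in X * _]/vdot mulr_suml; apply: eq_bigr => i _; rewrite mulrA.
have mgf_le : \int[P]_w expR (vdot theta (W w)) <= expR (b * vdot theta mu).
  apply: Rintegral_expR_le => //.
    have := @integrable_sum _ _ _ P _ measurableT _ (index_enum 'I_k) xpredT _
      (fun i _ => iWi i).
    by under eq_fun do rewrite sumEFin -sumE.
  under eq_Rintegral do rewrite sumE.
  rewrite Rintegral_sum// /vdot mulr_sumr mulr_suml.
  apply: ler_sum => i _; rewrite RintegralZl//.
  by apply: le_trans (tilted i) _; rewrite le_eqVlt; apply/predU1P; left; ring.
have mX : measurable_fun [set: T] (vdot theta \o W).
  exact: (measurableT_comp (measurable_vdot theta) (measurable_funPT W)).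
pose X : {RV P >-> R} := HB.pack (vdot theta \o W)
  (isMeasurableFun.Build _ _ _ _ _ mX).
have mXs : measurable [set w | X w >= s].
  by rewrite -[X in measurable X]setTI; apply: measurable_fun_ler.
apply: (@le_trans _ _ (P [set w | X w >= s])).
  by apply: le_measure; rewrite ?inE//.
(* Chernoff is used at parameter 1, the scale being already contained in [theta]. *)
apply: le_trans (chernoff X s ltr01) _.
rewrite /mmt_gen_fun expRD mul1r EFinM lee_pmul2r ?lte_fin ?expR_gt0//.
suff -> : ('E_P[expR \o 1 \o* X] = (\int[P]_w expR (vdot theta (W w)))%:E)%E.
  by rewrite lee_fin.
rewrite unlock fineK ?integrable_fin_num//.
by apply: eq_integral => w _; rewrite /= mulr1.
Qed.

(* [e = 1] is the upper tail and [e = -1] the lower one. *)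
Lemma size_biased_tail (R : realType) (n : nat) (d : measure_display)
  (T : measurableType d) (P : probability T R)
  (W : {RV P >-> n.+1.-tuple R}) (mu sigma : n.+1.-tuple R) (K : R)
  (W_mean : forall i : 'I_n.+1, ('E_P[coordinate W i] = (tnth mu i)%:E)%E)
  (mu_gt0 : forall i : 'I_n.+1, 0 < tnth mu i)
  (sigma_gt0 : forall i : 'I_n.+1, 0 < tnth sigma i)
  (W_mgf : forall theta : n.+1.-tuple R,
    ('E_P[fun w => expR (vdot theta (W w))] < +oo)%E)
  (K_gt0 : 0 < K)
  (W_coupling : forall i : 'I_n.+1,
    exists (d' : measure_display) (T' : measurableType d')
      (P' : probability T' R) (W' Wi : {RV P' >-> n.+1.-tuple R}),
      [/\ same_law W' W,
          size_biased W Wi i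
        & {ae P', forall w, l2norm (vsub (Wi w) (W' w)) <= K}])
  (t : n.+1.-tuple R) (t_ge0 : vle (vzero R n.+1) t)
  (e : R) (he : e = 1 \/ e = -1) (c : R) (c_ge0 : 0 <= c) :
  exists a : R, 0 <= a <= c * l2norm t * (K / vmin sigma) /\
  (P [set w | forall i,
      (tnth t i <= e * ((tnth (W w) i - tnth mu i) / tnth sigma i))%R] <=
   (expR (e * (expR (e * a) - 1) * (c * vdot t (vdiv mu sigma)) -
     c * l2norm t ^+ 2))%:E)%E.
Proof.
have {}t_ge0 i : 0 <= tnth t i by have := t_ge0 i; rewrite tnth_mktuple.
have sigma1_gt0 := vmin_gt0 sigma_gt0.
(* The scale [c] stays free, to be optimised separately for each tail. *)
pose theta : n.+1.-tuple R :=
  [tuple e * (c * (tnth t i / tnth sigma i)) | i < n.+1].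
have thetaE i : tnth theta i = e * (c * (tnth t i / tnth sigma i)).
  by rewrite tnth_mktuple.
exists (l2norm theta * K); split.
  rewrite mulr_ge0 ?sqrtr_ge0 ?(ltW K_gt0)//=.
  rewrite mulrA mulrAC ler_pM2r// mulrAC.
  apply: l2norm_le_scale => [|i]; first by rewrite divr_ge0// ltW.
  have e1 : `|e| = 1 by case: he => ->; rewrite ?normrN normr1.
  rewrite thetaE normrM e1 mul1r normrM (ger0_norm c_ge0) -mulrA ler_wpM2l//.
  rewrite normrM mulrC ler_wpM2r// gtr0_norm ?invr_gt0//.
  by rewrite lef_pV2 ?posrE// vmin_le.
set a := l2norm theta * K.
have theta_mu : vdot theta mu = e * (c * vdot t (vdiv mu sigma)).
  rewrite /vdot !mulr_sumr; apply: eq_bigr => i _.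
  rewrite thetaE tnth_mktuple; ring.
pose A i :=
  [set w | tnth t i <= e * ((tnth (W w) i - tnth mu i) / tnth sigma i)].
have mA i : measurable (A i).
  rewrite -[A i]setTI; apply: measurable_fun_ler => //.
  apply: measurable_funM => //; apply: measurable_funM => //.
  apply: measurable_funB => //.
  exact: (measurableT_comp (measurable_tnth i) (measurable_funPT W)).
rewrite [X in P X](_ : _ = \bigcap_(i in [set: 'I_n.+1]) A i); last first.
  by apply/seteqP; split => [w Aw i _|w Aw i]; [exact: Aw|exact: (Aw i I)].
(* The threshold is [vdot theta mu + c * l2norm t ^+ 2]; its first summand accounts for the [- 1]
   next to [expR (e * a)]. *)
have -> : e * (expR (e * a) - 1) * (c * vdot t (vdiv mu sigma)) -
    c * l2norm t ^+ 2 = expR (e * a) * vdot theta mu -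
    (vdot theta mu + c * l2norm t ^+ 2) by rewrite theta_mu; ring.
apply: vdot_tail_le => //.
- move=> i; have [d' [T' [P' [W' [Wi [law biased close]]]]]] := W_coupling i.
  have /andP[lo up] := tilted_mean_bounds theta W_mgf (W_mean i)
    (ltW (mu_gt0 i)) law biased close.
  have r_ge0 : 0 <= c * (tnth t i / tnth sigma i).
    by rewrite mulr_ge0 ?divr_ge0// ltW.
  (* For [e = 1] the tilt is nonnegative and the upper bound applies; for [e = -1] the sign turns
     the lower bound around. *)
  rewrite thetaE; case: he => ->.
    by rewrite !mul1r; apply: ler_wpM2l.
  by rewrite !mulN1r !mulNr lerN2; apply: ler_wpM2l.
- by apply: fin_bigcap_measurable.
- move=> w Aw; rewrite /l2norm sqr_sqrtr ?sumr_ge0// => [|i _]; last first.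
    exact: sqr_ge0.
  rewrite mulr_sumr /vdot -big_split/=; apply: ler_sum => i _.
  have := Aw i I; rewrite /A/= => Ai.
  rewrite -lerBrDl -mulrBr thetaE.
  have -> : e * (c * (tnth t i / tnth sigma i)) * (tnth (W w) i - tnth mu i) =
    c * (tnth t i * (e * ((tnth (W w) i - tnth mu i) / tnth sigma i))) by ring.
  by rewrite ler_wpM2l// expr2 ler_wpM2l.
Qed.

(** * Choice of the scale in each tail *)

Theorem theorem2p1 (R : realType) (n : nat) (d : measure_display)
  (T : measurableType d) (P : probability T R)
  (W : {RV P >-> n.+1.-tuple R}) (mu sigma : n.+1.-tuple R) (K : R)
  (W_ge0 : forall i : 'I_n.+1, {ae P, forall w, 0 <= coordinate W i w})
  (W_mean : forall i : 'I_n.+1, ('E_P[coordinate W i] = (tnth mu i)%:E)%E)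
  (mu_gt0 : forall i : 'I_n.+1, 0 < tnth mu i)
  (W_var : forall i : 'I_n.+1,
    ('V_P[coordinate W i] = (tnth sigma i ^+ 2)%:E)%E)
  (sigma_gt0 : forall i : 'I_n.+1, 0 < tnth sigma i)
  (W_mgf : forall theta : n.+1.-tuple R,
    ('E_P[fun w => expR (vdot theta (W w))] < +oo)%E)
  (K_gt0 : 0 < K)
  (W_coupling : forall i : 'I_n.+1,
    exists (d' : measure_display) (T' : measurableType d')
      (P' : probability T' R) (W' Wi : {RV P' >-> n.+1.-tuple R}),
      [/\ same_law W' W,
          size_biased W Wi i
        & {ae P', forall w, l2norm (vsub (Wi w) (W' w)) <= K}]) :
  let K1 := 2 * K / vmin sigma * l2norm (vdiv mu sigma) in
  let K2 := K / (2 * vmin sigma) in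
  forall t : n.+1.-tuple R, vle (vzero R n.+1) t ->
    (P [set w | vle (vdiv (vsub (W w) mu) sigma) (vopp t)]
       <= (expR (- (l2norm t ^+ 2 / (2 * K1))))%:E)%E /\
    (P [set w | vle t (vdiv (vsub (W w) mu) sigma)]
       <= (expR (- (l2norm t ^+ 2 / (2 * (K1 + K2 * l2norm t)))))%:E)%E.
Proof.
move=> K1 K2 t t_ge0.
have sigma1_gt0 := vmin_gt0 sigma_gt0.
set N := l2norm (vdiv mu sigma); set r := l2norm t.
have r_ge0 : 0 <= r by exact: sqrtr_ge0.
have t_mu_ge0 : 0 <= vdot t (vdiv mu sigma).
  apply: sumr_ge0 => i _; have := t_ge0 i; rewrite !tnth_mktuple => ti.
  by rewrite mulr_ge0// divr_ge0// ltW.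
have t_mu_le : vdot t (vdiv mu sigma) <= r * N.
  exact: le_trans (ler_norm _) (norm_vdot_le _ _).
have N_gt0 : 0 < N.
  rewrite /N /l2norm sqrtr_gt0 big_ord_recl ltr_pwDl//.
    by rewrite tnth_mktuple exprn_gt0// divr_gt0.
  by apply: sumr_ge0 => i _; exact: sqr_ge0.
pose kappa := K / vmin sigma.
have kappa_gt0 : 0 < kappa by rewrite divr_gt0.
have K1E : K1 = 2 * kappa * N by rewrite /K1 /kappa mulrA.
have K2E : K2 = kappa / 2 by rewrite /K2 /kappa invfM mulrA mulrAC.
have K1_gt0 : 0 < K1 by rewrite K1E mulr_gt0// mulr_gt0.
have D_gt0 : 0 < K1 + K2 * r.
  by rewrite ltr_pwDl// K2E mulr_ge0// divr_ge0// ltW.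
have tail := size_biased_tail W_mean mu_gt0 sigma_gt0 W_mgf K_gt0
  W_coupling t_ge0.
rewrite -/r -/kappa in tail.
split.
(* Lower tail with [c = K1^-1]: as [kappa * N = K1 / 2], bounding [1 - expR (- a)] by [a] makes the
   positive term of the exponent at most half of [c * r ^+ 2]. *)
- have c_ge0 : 0 <= K1^-1 by rewrite invr_ge0 ltW.
  have [a [/andP[a_ge0 a_le]]] := tail (-1) (or_intror erefl) _ c_ge0.
  rewrite [X in P X](_ : _ =
      [set w | vle (vdiv (vsub (W w) mu) sigma) (vopp t)]); last first.
    by apply/seteqP; split => w h i; have := h i;
      rewrite !tnth_mktuple mulN1r lerNr.
  move=> /le_trans; apply; rewrite lee_fin ler_expR.
  have : 1 - expR (- a) <= a by have := expR_ge1Dx (- a); lra.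
  rewrite !mulN1r opprB => expa_le.
  set V := vdot _ _ in t_mu_ge0 t_mu_le *; set c := K1^-1 in c_ge0 a_le *.
  have V_ge0 : 0 <= c * V by rewrite mulr_ge0.
  have : (1 - expR (- a)) * (c * V) <= c * r * kappa * (c * (r * N)).
    apply: (@le_trans _ _ (a * (c * V))); first exact: ler_wpM2r.
    by apply: ler_pM => //; exact: ler_wpM2l.
  have -> : c * r * kappa * (c * (r * N)) = r ^+ 2 / (2 * K1).
    by rewrite /c K1E; field; rewrite !gt_eqF.
  have -> : c * r ^+ 2 = 2 * (r ^+ 2 / (2 * K1)).
    by rewrite /c; field; rewrite gt_eqF.
  lra.
- have c_ge0 : 0 <= (K1 + K2 * r)^-1 by rewrite invr_ge0 ltW.
  have [a [/andP[a_ge0 a_le]]] := tail 1 (or_introl erefl) _ c_ge0.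
  rewrite [X in P X](_ : _ =
      [set w | vle t (vdiv (vsub (W w) mu) sigma)]); last first.
    by apply/seteqP; split => w h i; have := h i; rewrite !tnth_mktuple mul1r.
  move=> /le_trans; apply; rewrite lee_fin ler_expR !mul1r.
  set V := vdot _ _ in t_mu_ge0 t_mu_le *; set D := K1 + K2 * r in D_gt0 *.
  set c := D^-1 in c_ge0 a_le *.
  have V_ge0 : 0 <= c * V by rewrite mulr_ge0.
  (* The choice [c = D^-1] gives this identity; with [a <= c * r * kappa] it yields
     [K1 * c <= 1 - a / 2], hence [a < 2]. *)
  have cr_eq : 1 - c * r * kappa / 2 = K1 * c.
    have : c * (K1 + kappa / 2 * r) = 1 by rewrite -K2E mulVf// gt_eqF.
    lra.
  have cK1_gt0 : 0 < K1 * c by rewrite mulr_gt0// invr_gt0.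
  have expa_le : expR a - 1 <= r / (2 * N).
    apply: le_trans (expRB1_le a_ge0 _) _; first lra.
    rewrite ler_pdivrMr; last by lra.
    (* The quotient [c * r * kappa / (K1 * c)] equals [r / (2 * N)], because
       [K1 = 2 * kappa * N]. *)
    apply: (@le_trans _ _ (r / (2 * N) * (K1 * c))).
      rewrite (_ : _ * (K1 * c) = c * r * kappa)//.
      by rewrite K1E; field; rewrite gt_eqF.
    by apply: ler_wpM2l; [rewrite divr_ge0// mulr_ge0// ltW|lra].
  (* The factor [N] cancels, so the positive term is again at most half of [c * r ^+ 2]. *)
  have : (expR a - 1) * (c * V) <= r / (2 * N) * (c * (r * N)).
    apply: ler_pM => //; last exact: ler_wpM2l.
    by have := expR_ge1Dx a; lra.
  have -> : r / (2 * N) * (c * (r * N)) = r ^+ 2 / (2 * D).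
    by rewrite /c; field; rewrite !gt_eqF.
  have -> : c * r ^+ 2 = 2 * (r ^+ 2 / (2 * D)).
    by rewrite /c; field; rewrite gt_eqF.
  lra.
Qed.
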